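(* Let $G$ be a clique tree in $\mathcal{CT}$ with odd diameter. The $\mathcal E$-spectrum of $G$ is symmetric if and only if $|C(G)|=2$.
   Context: Graphs are finite, simple and undirected. A cut-vertex of a connected graph $G$ is a vertex whose removal disconnects $G$; a block of $G$ is a maximal connected subgraph $B$ having no cut-vertices of its own (no cut-vertex of $B$). A clique tree is a connected graph whose blocks are all complete graphs. $\mathcal{CT}$ is the class of clique trees $G$ such that each block of $G$ contains at most two cut-vertices of $G$. For a connected graph $G$, $d_G(u,v)$ is the distance and $e_G(u)=\max\{d_G(u,v)\mid v\in V_G\}$ the eccentricity of $u$. The center $C(G)$ is the set of vertices of minimum eccentricity. The eccentricity matrix $\mathcal E(G)=(\epsilon_{uv})$, indexed by $V_G\times V_G$, has $\epsilon_{uv}=d_G(u,v)$ if $d_G(u,v)=\min\{e_G(u),e_G(v)\}$ and $\epsilon_{uv}=0$ otherwise. The $\mathcal E$-spectrum of $G$ is the multiset of eigenvalues of $\mathcal E(G)$; it is called symmetric if it is symmetric with respect to $0$, i.e. for every real $\lambda$ the multiplicities of $\lambda$ and $-\lambda$ as eigenvalues of $\mathcal E(G)$ are equal. *)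

(* Defs.v *)
From HB Require Import structures.
From mathcomp Require Import all_boot all_order all_algebra.
From mathcomp Require Import reals.

Set Implicit Arguments.
Unset Strict Implicit.
Unset Printing Implicit Defensive.

Import Order.TTheory GRing.Theory Num.Theory.

Record sgraph := SGraph {
  vertex :> finType;
  adj : rel vertex;
  adj_sym : symmetric adj;
  adj_irr : irreflexive adj
}.

(* Subgraphs are not required to be induced. *)
Record subgraph (G : sgraph) := Subgraph {
  sverts : {set G};
  sadj : rel G;
  sadj_sym : symmetric sadj;
  sadj_sub : forall x y, sadj x y -> [&& x \in sverts, y \in sverts & adj x y]
}.

Section Subgraphs.

Variable G : sgraph.
Implicit Types H B : subgraph G.

Fact whole_sub (x y : G) :
  adj x y -> [&& x \in [set: G], y \in [set: G] & adj x y].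
Proof. by rewrite !in_setT. Qed.

Definition whole : subgraph G := Subgraph (@adj_sym G) whole_sub.

Definition del_adj H (v : G) : rel G :=
  [rel x y | [&& x != v, y != v & sadj H x y]].

Fact del_adj_sym H v : symmetric (del_adj H v).
Proof. by move=> x y; rewrite /del_adj /= sadj_sym andbCA. Qed.

Fact del_adj_sub H v x y :
  del_adj H v x y ->
  [&& x \in sverts H :\ v, y \in sverts H :\ v & adj x y].
Proof.
by case/and3P=> xv yv /sadj_sub/and3P[xH yH xy]; rewrite !in_setD1 xv yv xH yH.
Qed.

Definition del_vertex H v : subgraph G :=
  Subgraph (@del_adj_sym H v) (@del_adj_sub H v).

(* The empty subgraph counts as connected here, so that the vertex of a
   one-vertex graph is not a cut-vertex; graphs are required to be nonempty
   separately, in [connected_graph]. *)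
Definition sub_connected H : bool :=
  [forall x in sverts H, forall y in sverts H, connect (sadj H) x y].

Definition cut_vertex H (v : G) : bool :=
  (v \in sverts H) && ~~ sub_connected (del_vertex H v).

Definition subgraph_le H1 H2 : Prop :=
  sverts H1 \subset sverts H2 /\ subrel (sadj H1) (sadj H2).

Definition connected_no_cut H : Prop :=
  sub_connected H /\ forall v, ~~ cut_vertex H v.

Definition block B : Prop :=
  connected_no_cut B /\
  forall H, connected_no_cut H -> subgraph_le B H -> subgraph_le H B.

Definition complete H : Prop :=
  forall x y, x \in sverts H -> y \in sverts H -> x != y -> sadj H x y.

End Subgraphs.

Definition connected_graph (G : sgraph) : Prop :=
  0 < #|G| /\ sub_connected (whole G).

Definition clique_tree (G : sgraph) : Prop :=
  connected_graph G /\ forall B : subgraph G, block B -> complete B.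

Definition in_CT (G : sgraph) : Prop :=
  clique_tree G /\
  forall B : subgraph G, block B ->
    #|[set v in sverts B | cut_vertex (whole G) v]| <= 2.

Section Metric.

Variable G : sgraph.
Implicit Types u v : G.

Definition walk (n : nat) u v : bool :=
  [exists p : n.-tuple G, path (@adj G) u p && (last u p == v)].

(* Least length of a walk from u to v; a shortest one has length < #|G|.
   The value is #|G| when there is none, i.e. never in a connected graph. *)
Definition dist u v : nat := find (fun n => walk n u v) (iota 0 #|G|).

Definition ecc u : nat := \max_(v : G) dist u v.

Definition center : {set G} := [set u | [forall v, ecc u <= ecc v]].

Definition ecc_entry u v : nat :=
  if dist u v == minn (ecc u) (ecc v) then dist u v else 0.

End Metric.

Definition diameter (G : sgraph) : nat := \max_(u : G) ecc u.

Local Open Scope ring_scope.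

Definition ecc_matrix (R : realType) (G : sgraph) : 'M[R]_#|G| :=
  \matrix_(i, j) (ecc_entry (enum_val i) (enum_val j))%:R.

Definition symmetric_spectrum (R : realType) (n : nat) (A : 'M[R]_n) : Prop :=
  forall lambda : R,
    mup lambda (char_poly A) = mup (- lambda) (char_poly A).

(* Main.v *)
Require Import Defs.
From mathcomp Require Import all_boot all_order all_algebra.
From mathcomp Require Import reals.
From mathcomp Require Import spectral sesquilinear complex zify.

(* Clique trees are 0-hyperbolic: for four points, the two largest of the three
   sums of opposite distances agree. This is proved on geodesically convex sets
   by splitting at a cut-vertex; a convex set without cut-vertex is a clique.
   The rest only uses this four-point condition. Let x, y be a diametral pair,
   d(x,y) = 2h+1. Then ecc w = max (d(w,x), d(w,y)), so the center consists of
   the two middle vertices of the x-y geodesic and of all the vertices at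
   distance h+1 from both x and y. If there is no vertex of the latter kind,
   every vertex is strictly closer to x or to y, entries between vertices on the
   same side vanish, and changing the sign of one side conjugates the matrix E
   to -E. Otherwise such a vertex w gives a triangle x, y, w of positive entries,
   so tr E^3 > 0, while tr E^3 = 0 for a symmetric spectrum, as E is
   diagonalizable with real eigenvalues. *)

Set Implicit Arguments.
Unset Strict Implicit.
Unset Printing Implicit Defensive.

(** * Distances, geodesics and the four-point condition *)

Section Walks.
Variable G : sgraph.
Implicit Types (u v w a b c d : G) (S : {set G}).

(** Walks of length at least [#|G|] are covered too, since [dist] never exceeds [#|G|]. *)
Lemma dist_le_path u v p :
  path (@adj G) u p -> last u p = v -> dist u v <= size p.
Proof.
move=> up lp; case: (ltnP (size p) #|G|) => sp; last first.
  by apply: leq_trans (find_size _ _) _; rewrite size_iota.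
rewrite leqNgt; apply/negP => /(before_find 0).
rewrite nth_iota // add0n => /negbT/existsPn/(_ (in_tuple p)).
by rewrite /= up lp eqxx.
Qed.

Lemma dist0 u : dist u u = 0.
Proof. by apply/eqP; rewrite -leqn0 (@dist_le_path _ _ [::]). Qed.

Hypothesis conG : sub_connected (whole G).

(** Connectedness gives a duplicate-free path, of length below [#|G|], so the search defining [dist]
    succeeds. *)
Lemma dist_path u v :
  exists p, [/\ path (@adj G) u p, last u p = v & size p = dist u v].
Proof.
suff h : has (fun n => walk n u v) (iota 0 #|G|).
  have := nth_find 0 h; rewrite nth_iota; last by rewrite -[X in _ < X](size_iota 0) -has_find.
  case/existsP=> p /andP[up /eqP lp].
  by exists p; rewrite size_tuple.
have /forall_inP/(_ u (in_setT _))/forall_inP/(_ v (in_setT _)) := conG.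
case/connectP=> p up lp; case/shortenP: up lp => q uq unq _ lq.
apply/hasP; exists (size q); last first.
  by rewrite /walk; apply/existsP; exists (in_tuple q); rewrite lq eqxx andbT; exact: uq.
rewrite mem_iota add0n /= -[(size q).+1]/(size (u :: q)) -(card_uniqP unq).
exact: max_card.
Qed.

Lemma dist_eq0 u v : (dist u v == 0) = (u == v).
Proof.
apply/eqP/eqP => [d0|->]; last exact: dist0.
by have [[|x p] []] := dist_path u v; rewrite d0.
Qed.

Lemma dist_triangle u v w : dist u w <= dist u v + dist v w.
Proof.
have [p [up lp <-]] := dist_path u v; have [q [vq lq <-]] := dist_path v w.
rewrite -size_cat dist_le_path ?last_cat ?lp //.
by rewrite cat_path up lp.
Qed.

Lemma dist_sym u v : dist u v = dist v u.
Proof.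
suff h (x y : G) : dist x y <= dist y x by apply/eqP; rewrite eqn_leq !h.
have [p [yp lp <-]] := dist_path y x.
rewrite -(size_belast y p) -size_rev dist_le_path //.
- by rewrite -lp rev_path; under eq_path do rewrite adj_sym.
- by case: p {yp} lp => [<-|z p _] //=; rewrite rev_cons last_rcons.
Qed.

Lemma dist_adj u v : adj u v -> dist u v = 1.
Proof.
move=> uv; apply/eqP; rewrite eqn_leq (@dist_le_path _ _ [:: v]) ?lt0n //=.
  by rewrite dist_eq0; apply: contraTneq uv => ->; rewrite adj_irr.
by rewrite uv.
Qed.

Lemma dist_step u v : u != v -> exists2 w, adj u w & dist u v = (dist w v).+1.
Proof.
rewrite -dist_eq0; have [[|w p] [/= up lp dp]] := dist_path u v.
  by rewrite -dp.
case/andP: up => uw wp _; exists w => //.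
have := dist_le_path wp lp; have := dist_triangle u w v; rewrite (dist_adj uw).
lia.
Qed.

Lemma geodesic_point u v k :
  k <= dist u v -> exists2 w, dist u w = k & dist u v = k + dist w v.
Proof.
elim: k => [_|k IHk lt_k]; first by exists u; rewrite ?dist0.
have [w uw uv] := IHk (ltnW lt_k).
have wv : w != v by rewrite -dist_eq0; lia.
have [z wz dz] := dist_step wv; exists z; last lia.
have := dist_triangle u w z; have := dist_triangle u z v.
rewrite (dist_adj wz); lia.
Qed.

Definition four_point a b c d : bool :=
  dist a b + dist c d <= maxn (dist a c + dist b d) (dist a d + dist b c).

Definition geodesically_convex (S : {set G}) : Prop :=
  forall u v w, u \in S -> v \in S -> dist u w + dist w v = dist u v -> w \in S.

Definition ind_adj (S : {set G}) : rel G :=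
  [rel u v | [&& u \in S, v \in S & adj u v]].

Fact ind_adj_sym (S : {set G}) : symmetric (ind_adj S).
Proof. by move=> u v; rewrite /ind_adj /= adj_sym andbCA. Qed.

Fact ind_adj_sub (S : {set G}) u v :
  ind_adj S u v -> [&& u \in S, v \in S & adj u v].
Proof. by []. Qed.

Definition induced (S : {set G}) : subgraph G :=
  Subgraph (@ind_adj_sym S) (@ind_adj_sub S).

Lemma convex_connected S : geodesically_convex S -> sub_connected (induced S).
Proof.
move=> cvS; apply/forall_inP=> u /= uS; apply/forall_inP=> v /= vS.
elim: {u}(dist u v) {-2}u (erefl (dist u v)) uS => [|n IHn] u duv uS.
  by move/eqP: duv; rewrite dist_eq0 => /eqP->; exact: connect0.
have uv : u != v by rewrite -dist_eq0 duv.
have [w uw dw] := dist_step uv.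
have wS : w \in S by apply: (cvS u v) => //; rewrite (dist_adj uw) dw.
apply: connect_trans (connect1 _) (IHn w _ wS); last lia.
by rewrite /ind_adj /= uS wS.
Qed.

(** * Splitting a convex set at a vertex *)

Section CutSplit.
Variables (S : {set G}) (v p : G).
Hypotheses (cvS : geodesically_convex S) (vS : v \in S).
Let E := del_adj (induced S) v.

(** The strict inequality says that no geodesic from [u] to [w] meets [v], and convexity keeps such
    a geodesic in [S]. *)
Lemma connect_avoid u w : u \in S -> w \in S -> u != v ->
  dist u w < dist u v + dist v w -> connect E u w.
Proof.
move=> uS wS; elim: {u}(dist u w) {-2}u (erefl (dist u w)) uS => [|n IHn] u.
  by move=> /eqP; rewrite dist_eq0 => /eqP->; rewrite connect0.
move=> duw uS uv avoid.
have uw : u != w by rewrite -dist_eq0 duw.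
have [z uz dz] := dist_step uw.
have zS : z \in S by apply: (cvS uS wS); rewrite (dist_adj uz) dz.
have zv : z != v by apply: contraTneq avoid => <-; rewrite (dist_adj uz) dz -leqNgt.
have := dist_triangle u z v; rewrite (dist_adj uz) => tr.
apply: connect_trans (connect1 _) (IHn z _ zS zv _); [|lia|lia].
by rewrite /E /del_adj /= uv zv /ind_adj /= uS zS.
Qed.

(** For [p] in [S] other than [v], [side true] is the component of [p] in [S] minus [v] and
    [side false] gathers the others; [v] itself lies in both. *)
Definition side (b : bool) : {set G} :=
  [set z in S | (z == v) || (connect E p z == b)].

(** Otherwise [connect_avoid] would join [u] to [w] without passing through [v]. *)
Lemma side_separated (b : bool) u w :
  u \in side b -> w \in side (~~ b) -> dist u w = dist u v + dist v w.
Proof.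
rewrite !inE => /andP[uS]; case: (eqVneq u v) => [->|uv /= /eqP pu].
  by rewrite dist0.
move=> /andP[wS]; case: (eqVneq w v) => [->|wv /= /eqP pw].
  by rewrite dist0 addn0.
apply/eqP; rewrite eqn_leq dist_triangle leqNgt; apply/negP=> lt_uw.
have Euw := connect_avoid uS wS uv lt_uw.
have symE : connect_sym E by apply: sym_connect_sym; exact: del_adj_sym.
have := same_connect_r symE Euw p; rewrite pu pw.
by case: b {pu pw}.
Qed.

(** A geodesic leaving the side would cross [v] on the way out and again on the way back, a detour
    of twice the distance from [v] to [z]. *)
Lemma side_convex (b : bool) : geodesically_convex (side b).
Proof.
move=> u w z ub wb dz.
have zS : z \in S by apply: cvS dz; [move: ub | move: wb]; rewrite inE => /andP[].
apply/negPn/negP=> zNb.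
have zb : z \in side (~~ b).
  by move: zNb; rewrite !inE zS /=; case: (z == v); case: connect; case: (b).
have zv : z != v by apply: contraNneq zNb => ->; rewrite inE vS eqxx.
have := side_separated ub zb; have := side_separated wb zb.
have := dist_triangle u v w; rewrite -dist_eq0 in zv.
have := dist_sym z w; have := dist_sym z v; have := dist_sym w v; lia.
Qed.

Lemma side_cover z : z \in S -> exists b : bool, z \in side b.
Proof. by move=> zS; exists (connect E p z); rewrite inE zS eqxx orbT. Qed.

End CutSplit.

Hypothesis clique : forall H : subgraph G, connected_no_cut H ->
  forall u v, u \in sverts H -> v \in sverts H -> u != v -> adj u v.

Lemma four_point_convex S a b c d : geodesically_convex S ->
  a \in S -> b \in S -> c \in S -> d \in S -> four_point a b c d.
Proof.
have [n] := ubnP #|S|; elim: n => // n IHn in S a b c d *.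
move=> leSn cvS aS bS cS dS.
case: (pickP [pred v | cut_vertex (induced S) v]) => [v /= | nocut]; last first.
  have dist1 u w : u \in S -> w \in S -> dist u w = (u != w).
    move=> uS wS; case: (eqVneq u w) => [->|uw]; first by rewrite dist0.
    rewrite dist_adj // (@clique (induced S) _ u w uS wS uw) //; split; first exact: convex_connected.
    by move=> x; move: (nocut x) => /= ->.
  rewrite /four_point !dist1 //.
  have [<-|_] := eqVneq a c; first by rewrite addnC (eq_sym a b) leq_maxr.
  have [<-|_] := eqVneq b d; first by rewrite (eq_sym c b) leq_maxr.
  (* Here [a != c] and [b != d], so the first sum on the right is 2. *)
  by apply: leq_trans (leq_maxl _ _); do 2 case: eqP.
case/andP=> vS /forall_inPn[p pS /forall_inPn[q qS npq]].
have sideS s : geodesically_convex (side S v p s) by exact: side_convex.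
have IH s : forall x y z t, x \in side S v p s -> y \in side S v p s ->
    z \in side S v p s -> t \in side S v p s -> four_point x y z t.
  move=> x y z t; apply: IHn (sideS s).
  apply: leq_trans (proper_card _) (leSn : #|S| <= n); apply/properP; split.
    by apply/subsetP=> u; rewrite inE => /andP[].
  move: pS qS; rewrite !inE => /andP[pv pS] /andP[qv qS].
  (* Each side is a proper subset of [S]: [side true] misses [q] and [side false] misses [p]. *)
  case: s; [exists q | exists p] => //; rewrite inE ?(negPf pv) ?(negPf qv) ?connect0 ?andbF //=.
  by rewrite (negPf npq) andbF.
have vs s : v \in side S v p s by rewrite inE vS eqxx.
(* Each point is paired with its projections to the two sides, the one on the
   opposite side being v; distances add up over the two sides. *)
have split u w x y : u \in side S v p x -> w \in side S v p y ->
    dist u w = dist (if x then u else v) (if y then w else v) +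
               dist (if x then v else u) (if y then v else w).
  case: x; case: y => us ws; rewrite ?dist0 ?addn0 //; last rewrite addnC;
  by rewrite (side_separated cvS vS us ws).
have [x ax] := side_cover v p aS; have [y bx] := side_cover v p bS.
have [z cx] := side_cover v p cS; have [t dx] := side_cover v p dS.
have IH2 s : four_point (if x == s then a else v) (if y == s then b else v)
                         (if z == s then c else v) (if t == s then d else v).
  by apply: (IH s); case: eqP => // <-.
rewrite /four_point (split _ _ _ _ ax bx) (split _ _ _ _ cx dx) (split _ _ _ _ ax cx)
  (split _ _ _ _ bx dx) (split _ _ _ _ ax dx) (split _ _ _ _ bx cx).
(* Maxima do not add up in general, hence the sixteen placements. With at least three points on one
   side, the three sums on the other side coincide; with two on each, a common pairing on the right
   attains both maxima. *)
move: (IH2 true) (IH2 false); rewrite /four_point; move: (x) (y) (z) (t).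
clear -conG; do 4 case; rewrite /= ?dist0
  ?(dist_sym v a) ?(dist_sym v b) ?(dist_sym v c) ?(dist_sym v d).
all: lia.
Qed.

End Walks.

(** * From complete blocks to the four-point condition *)

Section CliqueTrees.
Variable G : sgraph.

Lemma connected_no_cut_clique (H : subgraph G) u v :
    (forall B : subgraph G, block B -> complete B) -> connected_no_cut H ->
  u \in sverts H -> v \in sverts H -> u != v -> adj u v.
Proof.
move=> clB; have [//|nuv] := boolP (adj u v).
(* Subgraphs need not be induced, so the size counts vertices and ordered adjacent pairs; the
   induction is on what is left to add. *)
pose size_of (B : subgraph G) :=
  #|sverts B| + #|[set e : G * G | sadj B e.1 e.2]|.
have [n] := ubnP (#|G| + #|{: G * G}| - size_of H).
elim: n => // n IHn in H *; rewrite ltnS => leHn cncH uH vH uv.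
(* Any strictly larger connected subgraph without cut-vertices is excluded by
   induction, so H is itself a block. *)
have blH : block H.
  split=> // K cncK [vHK aHK].
  have [sub|nsub] := boolP ((sverts K \subset sverts H) &&
    [forall e : G * G, sadj K e.1 e.2 ==> sadj H e.1 e.2]).
    case/andP: sub => sub /forallP eKH; split=> // a b Kab.
    by have /implyP := eKH (a, b); apply.
  have subE : [set e : G * G | sadj H e.1 e.2] \subset [set e : G * G | sadj K e.1 e.2].
    by apply/subsetP=> e; rewrite !inE; apply: aHK.
  have lt_HK : size_of H < size_of K.
    case/nandP: nsub => [nsub|/forallPn[e]].
      rewrite /size_of -addSn leq_add ?(subset_leq_card subE) //.
      by rewrite proper_card // properE vHK.
    rewrite negb_imply => /andP[Ke nHe].
    rewrite /size_of -addnS leq_add ?(subset_leq_card vHK) //.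
    rewrite proper_card // properE subE; apply/subsetPn.
    by exists e; rewrite inE.
  have l1 : #|sverts K| <= #|G| := max_card _.
  have l2 : #|[set e : G * G | sadj K e.1 e.2]| <= #|{: G * G}| := max_card _.
  suff: false by []; apply: (IHn K) => //; [|exact: (subsetP vHK)|exact: (subsetP vHK)].
  have {l1 l2} leK : size_of K <= #|G| + #|{: G * G}| by exact: leq_add.
  by apply: leq_trans leHn; apply: ltn_sub2l => //; exact: leq_trans leK.
have /sadj_sub/and3P[_ _] := clB H blH u v uH vH uv.
by rewrite (negPf nuv).
Qed.

Lemma clique_tree_four_point :
  clique_tree G -> forall a b c d : G, four_point a b c d.
Proof.
case=> [[_ conG] clB] a b c d.
apply: (@four_point_convex G conG _ setT); rewrite ?inE //.
by move=> H cncH u v; exact: connected_no_cut_clique.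
Qed.

End CliqueTrees.

(** * Eccentricities and center under the four-point condition *)

Section Hyperbolic.
Variable G : sgraph.
Hypotheses (conG : sub_connected (whole G))
  (hyp : forall a b c d : G, four_point a b c d) (odd_diam : odd (diameter G)).

Lemma leq_ecc (u v : G) : dist u v <= ecc u.
Proof. exact: leq_bigmax. Qed.

Lemma diametral_pair : exists x y : G, dist x y = diameter G.
Proof.
have G_gt0 : 0 < #|G|.
  by case: posnP odd_diam => // /card0_eq G0; rewrite /diameter big_pred0.
have [x dx] := eq_bigmax (@ecc G) G_gt0; have [y dy] := eq_bigmax (dist x) G_gt0.
by exists x, y; rewrite /diameter dx /ecc dy.
Qed.

Lemma leq_diameter (u v : G) : dist u v <= diameter G.
Proof. by apply: leq_trans (leq_ecc u v) _; exact: leq_bigmax. Qed.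

Section DiametralPair.
Variables (x y : G).
Hypothesis dxy : dist x y = diameter G.

(** In the four-point inequality for [w], [z], [x], [y], the distances from [z] are at most
    [dist x y] and cancel against it. *)
Lemma ecc_diametral w : ecc w = maxn (dist w x) (dist w y).
Proof.
apply/eqP; rewrite eqn_leq geq_max !leq_ecc !andbT; apply/bigmax_leqP => z _.
have := hyp w z x y; have := leq_diameter z y; have := leq_diameter z x.
by rewrite /four_point dxy; lia.
Qed.

(** The four-point inequality for [z], [t], [x], [y] puts [dist z t] strictly below both
    eccentricities, [dist z y] and [dist t y]. *)
Lemma same_side_entry z t : dist z x < dist z y -> dist t x < dist t y ->
  ecc_entry z t = 0.
Proof.
move=> zxy txy; rewrite /ecc_entry !ecc_diametral.
have := hyp z t x y; have := leq_diameter t y; have := leq_diameter z y.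
by rewrite /four_point dxy; case: eqP => //; lia.
Qed.

Variable h : nat.
Hypothesis dh : diameter G = h.*2.+1.

Let dsym := dist_sym conG.
Let dtri := dist_triangle conG.

Lemma near_center : exists2 u, dist u x = h & dist u y = h.+1.
Proof.
have [|u du dv] := @geodesic_point _ conG x y h; first by rewrite dxy dh; lia.
by exists u; [rewrite dsym | move: dv; rewrite dxy dh; lia].
Qed.

(** The least eccentricity is [h.+1]: [near_center] attains it, and the triangle inequality forbids
    less, as [dist x y] is [h.*2.+1]. *)
Lemma in_center w : (w \in center G) = (dist w x <= h.+1) && (dist w y <= h.+1).
Proof.
rewrite inE; apply/forallP/andP => [min_w|[wx wy] z].
  have [u ux uy] := near_center; have := min_w u.
  by rewrite !ecc_diametral ux uy; lia.
by rewrite !ecc_diametral; have := dtri x z y; rewrite (dsym x z) dxy dh; lia.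
Qed.

(** The four-point inequality reads [dist w u + h.*2.+1 <= h + h.+1]. *)
Lemma center_unique u w : dist u x = h -> dist u y = h.+1 ->
  dist w x = h -> dist w y = h.+1 -> w = u.
Proof.
move=> ux uy wx wy; apply/eqP; rewrite -(dist_eq0 conG).
by have := hyp w u x y; rewrite /four_point ux uy wx wy dxy dh; lia.
Qed.

Lemma equidistant_center z : dist z x = dist z y ->
  exists2 w, dist w x = h.+1 & dist w y = h.+1.
Proof.
move=> zxy; have := dtri x z y; rewrite (dsym x z) dxy dh => tr.
(* The witness lies on a geodesic from [z] to [x]; the four-point inequality bounds its distance to
   [y] from above, the triangle inequality from below. *)
have [|w zw dw] := @geodesic_point _ conG z x (dist z x - h.+1); first by lia.
exists w; first lia.
have := hyp w y z x; have := dtri z w y.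
by rewrite /four_point (dsym y x) dxy dh (dsym y z) (dsym w z); lia.
Qed.

End DiametralPair.

Lemma diametral_structure : exists x y h u v,
  [/\ [/\ dist x y = diameter G, dist y x = diameter G & diameter G = h.*2.+1],
      dist u x = h /\ dist u y = h.+1, dist v y = h /\ dist v x = h.+1,
      u != v & [set u; v] \subset center G].
Proof.
have [x [y dxy]] := diametral_pair; have dyx := dxy; rewrite dist_sym // in dyx.
have dh : diameter G = (diameter G)./2.*2.+1.
  by rewrite -[LHS]odd_double_half odd_diam.
have [u ux uy] := near_center dxy dh; have [v vy vx] := near_center dyx dh.
exists x, y, (diameter G)./2, u, v; split=> //.
  by apply/eqP => uv; move: vx; rewrite -uv ux; lia.
by apply/subsetP=> w /set2P[]->; rewrite (in_center dxy dh) ?ux ?uy ?vx ?vy ?leqnn ?leqnSn.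
Qed.

Lemma center_two_bipartite : #|center G| = 2 ->
  exists s : pred G, forall z t, s z = s t -> ecc_entry z t = 0.
Proof.
move=> card_center.
have [x [y [h [u [v [[dxy dyx dh] [ux uy] [vy vx] uv sub]]]]]] := diametral_structure.
have centerE : center G = [set u; v].
  by apply/esym/eqP; rewrite eqEcard sub card_center cards2 uv.
(* An equidistant vertex would yield a central vertex different from [u] and [v]. *)
have neq z : dist z x != dist z y.
  apply/eqP => zxy; have [w wx wy] := equidistant_center dxy dh zxy.
  have : w \in center G by rewrite (in_center dxy dh) wx wy leqnn.
  by rewrite centerE => /set2P[] wE; move: wx wy; rewrite wE; lia.
exists (fun z => dist z x < dist z y) => z t.
have [zl /esym tl|zg /esym/negbT tg] := boolP (dist z x < dist z y).
  exact: same_side_entry dxy _ _ zl tl.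
by apply: (same_side_entry dyx); rewrite ltn_neqAle eq_sym neq leqNgt.
Qed.

Lemma center_not_two_triangle : #|center G| != 2 ->
  exists a b c : G, [/\ 0 < ecc_entry a b, 0 < ecc_entry b c & 0 < ecc_entry c a].
Proof.
move=> card_center.
have [x [y [h [u [v [[dxy dyx dh] [ux uy] [vy vx] uv sub]]]]]] := diametral_structure.
have /subsetPn[w wC wN] : ~~ (center G \subset [set u; v]).
  apply: contra card_center => sub'.
  by rewrite (_ : center G = [set u; v]) ?cards2 ?uv //; apply/eqP; rewrite eqEsubset sub'.
(* Both distances are at most [h.+1] with sum at least [h.*2.+1]; uniqueness excludes the two cases
   where one of them is [h]. *)
have [wx wy] : dist w x = h.+1 /\ dist w y = h.+1.
  move: wC wN; rewrite (in_center dxy dh) !inE negb_or => /andP[wx wy] /andP[wu wv].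
  have := dist_triangle conG x w y; rewrite (dist_sym conG x w) dxy dh => tr.
  have nu : ~ (dist w x = h /\ dist w y = h.+1).
    by case=> wx' wy'; rewrite (center_unique dxy dh ux uy wx' wy') eqxx in wu.
  have nv : ~ (dist w y = h /\ dist w x = h.+1).
    by case=> wy' wx'; rewrite (center_unique dyx dh vy vx wy' wx') eqxx in wv.
  lia.
(* The eccentricities of [x], [y], [w] are [h.*2.+1], [h.*2.+1], [h.+1], so each distance equals the
   minimum in its entry. *)
exists x, y, w; rewrite /ecc_entry !(ecc_diametral dxy) !dist0.
rewrite dxy dyx (dist_sym conG y w) wx wy dh.
by split; case: eqP => //; lia.
Qed.

End Hyperbolic.

Import Order.TTheory GRing.Theory Num.Theory.

(** * Symmetric spectra of real matrices *)

Section SymmetricSpectrum.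
Local Open Scope ring_scope.

Lemma char_poly_conj (F : fieldType) n (P A : 'M[F]_n) :
  P \in unitmx -> char_poly (invmx P *m A *m P) = char_poly A.
Proof.
move=> Pu; pose Q := map_mx (polyC (R := F)) P; pose Q' := map_mx (polyC (R := F)) (invmx P).
have QQ : Q' *m Q = 1%:M by rewrite -map_mxM mulVmx // map_mx1.
have -> : char_poly (invmx P *m A *m P) = \det (Q' *m char_poly_mx A *m Q).
  rewrite /char_poly /char_poly_mx !map_mxM mulmxBr mulmxBl.
  by rewrite scalar_mxC -(mulmxA _ Q' Q) QQ mulmx1.
by rewrite !det_mulmx mulrAC -det_mulmx QQ det1 mul1r.
Qed.

Lemma char_poly_opp (R : comNzRingType) n (A : 'M[R]_n) :
  char_poly (- A) = (-1) ^+ n * (char_poly A \Po (- 'X)).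
Proof.
rewrite /char_poly -[_ \Po _]/(comp_poly (- 'X) _) -det_map_mx -detZ; congr (\det _).
apply/matrixP=> i j; rewrite !mxE /= rmorphB /= rmorphMn /= comp_polyX comp_polyC.
by rewrite polyCN mulN1r opprB opprK mulNrn opprK addrC.
Qed.

Lemma mup_comp_opp (F : fieldType) (x : F) (p : {poly F}) :
  p != 0 -> mup (- x) (p \Po (- 'X)) = mup x p.
Proof.
(* One inequality suffices: the substitution is an involution, so the converse is the same bound for
   [p \Po (- 'X)]. *)
have le (y : F) q : q != 0 -> (mup y q <= mup (- y) (q \Po (- 'X)))%N.
  move=> q0; have q0' : q \Po (- 'X) != 0.
    by rewrite comp_poly2_eq0 // size_polyN size_polyX.
  rewrite mup_geq //; have : ('X - y%:P) ^+ mup y q %| q by rewrite -mup_geq.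
  case/dvdpP=> r {2}->; rewrite comp_polyM dvdp_mull // rmorphXn /=.
  rewrite rmorphB /= comp_polyX comp_polyC polyCN opprK -opprD.
  by rewrite exprNn -signr_odd dvdp_mull.
move=> p0; apply/eqP; rewrite eqn_leq le // andbT.
have p0' : p \Po (- 'X) != 0 by rewrite comp_poly2_eq0 // size_polyN size_polyX.
have := le (- x) _ p0'; rewrite opprK -comp_polyA.
by rewrite rmorphN /= comp_polyX opprK comp_polyXr.
Qed.

Lemma bipartite_symmetric_spectrum (R : realType) n (A : 'M[R]_n) (s : pred 'I_n) :
  (forall i j, s i = s j -> A i j = 0) -> symmetric_spectrum A.
Proof.
move=> sA x; pose D : 'M[R]_n := diag_mx (\row_i (-1) ^+ s i).
have DD : D *m D = 1%:M.
  rewrite mulmx_diag -diag_const_mx; congr diag_mx; apply/rowP=> i.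
  by rewrite !mxE -expr2 sqrr_sign.
have Du : D \in unitmx by case/mulmx1_unit: DD.
have iD : invmx D = D by rewrite -[RHS](mulKmx Du) DD mulmx1.
have DAD : invmx D *m A *m D = - A.
  apply/matrixP=> i j; rewrite iD mul_mx_diag mul_diag_mx !mxE.
  case: (boolP (s i == s j)) => [/eqP/sA->|]; first by rewrite mulr0 mul0r oppr0.
  by case: (s i); case: (s j) => // _; rewrite /= !(expr0, expr1, mulN1r, mul1r, mulr1, mulrN1).
rewrite -{1}(char_poly_conj A Du) DAD char_poly_opp.
have c0 : char_poly A != 0 by apply: monic_neq0; exact: char_poly_monic.
(* The sign factor is a nonzero constant and leaves multiplicities unchanged. *)
have root_sign y : ~~ root ((-1) ^+ n : {poly R}) y.
  by rewrite rootE -(rmorph_sign polyC) hornerC signr_eq0.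
by rewrite mupMr // -{1}(opprK x) mup_comp_opp.
Qed.

(** Over [R[i]] the matrix is hermitian, hence unitarily diagonalizable with real eigenvalues; both
    identities descend along the injection [f]. *)
Lemma symmetric_spectral (R : rcfType) n (A : 'M[R]_n) : A^T = A ->
  exists r : 'rV[R]_n, char_poly A = \prod_i ('X - (r 0 i)%:P) /\
    \tr (A *m A *m A) = \sum_i r 0 i ^+ 3.
Proof.
move=> symA; pose f : {rmorphism R -> R[i]%C} := real_complex R.
pose B := map_mx f A.
have Bherm : B \is hermsymmx.
  apply: realsym_hermsym.
    by apply/is_hermitianmxP; rewrite expr0 scale1r map_mx_id // map_trmx symA.
  by apply/mxOverP=> i j; rewrite mxE complex_real.
have /mxOverP Dreal := hermitian_spectral_diag_real Bherm.
have /hermitian_normalmx/orthomx_spectralP := Bherm.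
set P := spectralmx B; set d := spectral_diag B => BE.
have Pu : P \in unitmx by exact: spectral_unit.
pose r : 'rV[R]_n := map_mx (@complex.Re R) d.
have fr i : f (r 0 i) = d 0 i by rewrite mxE; exact: RRe_real (Dreal 0 i).
exists r; split.
  apply: (map_poly_inj f); rewrite map_char_poly -/B BE char_poly_conj //.
  rewrite char_poly_trig ?diag_mx_is_trig // rmorph_prod; apply: eq_bigr => i _.
  by rewrite rmorphB /= map_polyX map_polyC /= fr mxE eqxx.
apply: (fmorph_inj f); rewrite -trace_map_mx !map_mxM -/B BE.
rewrite !mulmxA !(mulmxK Pu) mxtrace_mulC !mulmxA mulmxV // mul1mx.
rewrite !mulmx_diag mxtrace_diag rmorph_sum; apply: eq_bigr => i _.
by rewrite rmorphXn /= fr !mxE !exprS expr0 mulr1 mulrA.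
Qed.

Lemma symmetric_spectrum_trace3 (R : realType) n (A : 'M[R]_n) :
  A^T = A -> symmetric_spectrum A -> \tr (A *m A *m A) = 0.
Proof.
move=> /symmetric_spectral[r [charA ->]] symm.
pose s := [seq r 0 i | i <- enum 'I_n].
have charE : char_poly A = \prod_(y <- s) ('X - y%:P) by rewrite charA big_map big_enum.
have sumE : \sum_i r 0 i ^+ 3 = \sum_(y <- s) y ^+ 3 by rewrite big_map big_enum.
(* Counts in [s] are root multiplicities, so the symmetry makes [s] a permutation of its negation;
   cubing is odd. *)
have perm : perm_eq s [seq - y | y <- s].
  apply/allP=> x _; apply/eqP; have := symm x; rewrite charE !mu_prod_XsubC => -> /=.
  by rewrite count_map; apply: eq_count => y /=; rewrite eqr_oppLR.
have : \sum_(y <- s) y ^+ 3 = - \sum_(y <- s) y ^+ 3.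
  rewrite {1}(perm_big _ perm) big_map -sumrN; apply: eq_bigr => y _.
  by rewrite exprNn -signr_odd expr1 mulN1r.
by move/eqP; rewrite sumE -addr_eq0 -mulr2n mulrn_eq0 => /eqP.
Qed.

Lemma triangle_asymmetric (R : realType) n (A : 'M[R]_n) i j k :
    A^T = A -> (forall a b, 0 <= A a b) ->
  0 < A i j -> 0 < A j k -> 0 < A k i -> ~ symmetric_spectrum A.
Proof.
move=> symA A0 ij jk ki /(symmetric_spectrum_trace3 symA)/eqP; apply/negP.
have AA0 a b : 0 <= (A *m A) a b by rewrite mxE sumr_ge0 // => c _; rewrite mulr_ge0.
(* All terms of the trace are nonnegative; the one isolated is [A i j * A j k * A k i]. *)
rewrite gt_eqF // /mxtrace (bigD1 i) //= ltr_wpDr //.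
  by apply: sumr_ge0 => a _; rewrite mxE sumr_ge0 // => c _; rewrite mulr_ge0.
rewrite mxE (bigD1 k) //= ltr_wpDr //; first by apply: sumr_ge0 => c _; rewrite mulr_ge0.
rewrite mulr_gt0 // mxE (bigD1 j) //= ltr_wpDr //; first by apply: sumr_ge0 => c _; rewrite mulr_ge0.
by rewrite mulr_gt0.
Qed.

End SymmetricSpectrum.

Theorem theorem4p2 (R : realType) (G : sgraph) (hG : in_CT G)
    (hdiam : odd (diameter G)) :
  symmetric_spectrum (ecc_matrix R G) <-> #|center G| = 2.
Proof.
have [treeG _] := hG; have hyp := clique_tree_four_point treeG.
have [[_ conG] _] := treeG; split.
  move=> symm; apply/eqP; apply: contraT => ncenter.
  have [a [b [c [ab bc ca]]]] := center_not_two_triangle conG hyp hdiam ncenter.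
  case: (@triangle_asymmetric R _ (ecc_matrix R G)
    (enum_rank a) (enum_rank b) (enum_rank c) _ _ _ _ _ symm).
  - by apply/matrixP=> i j; rewrite !mxE /ecc_entry (dist_sym conG) minnC.
  - by move=> i j; rewrite mxE ler0n.
  - by rewrite mxE !enum_rankK ltr0n.
  - by rewrite mxE !enum_rankK ltr0n.
  - by rewrite mxE !enum_rankK ltr0n.
case/(center_two_bipartite conG hyp hdiam) => s sE.
apply: (@bipartite_symmetric_spectrum _ _ _ (fun i => s (enum_val i))) => i j /sE ij.
by rewrite mxE ij.
Qed.
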